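(* Let $L_0$ be a countable language without a truth predicate, every sentence of which is meaningful and is valuated by its meaning either as true or as false. Assume that standard meanings are assigned to logical symbols, and that the sentence $T(\mathbf n)$ means: 'the sentence whose Gödel number has $\mathbf n$ as its numeral is true'. Then the extension $\mathcal L_T$ of $L_0$ defined in the context, with its sentences valuated by their meanings, has a semantical theory of truth. This valuation is equivalent to the valuation in which a sentence of $\mathcal L_T$ is true iff it is in $L(U)$ and false iff it is in $F(U)$. With the valuation by meanings, $\mathcal L_T$ has the closure property, satisfies the classical truth rules and is bivalent, $T$ is a truth predicate and $\neg T$ is a non-truth predicate for $\mathcal L_T$.
   Context: LANGUAGES. A language is a nonempty countable set of sentences of finite length, formed from a countable set of elements, with syntax rules for constructing well-formed sentences and formulas. Three properties of a language are used. Closure property: the language contains $\neg,\vee,\wedge,\rightarrow,\leftrightarrow,\forall,\exists$, and if $A,B$ are sentences of it, so are $\neg A$, $A\vee B$, $A\wedge B$, $A\rightarrow B$, $A\leftrightarrow B$. If $P(x_1,\dots,x_m)$, $m\ge 1$, is a formula of the language with $m$ free variables, then $P$ is called a predicate with arity $m$ and domain $D_P=D_P^1\times\cdots\times D_P^m$, each $D_P^i$ being a subset of a set $D$ of objects (the domain of discourse), if every object of $D$ is named by a term ($N_P^i$ denotes the set of terms naming the objects of $D_P^i$, and $N_P=N_P^1\times\cdots\times N_P^m$), and if for all $b_i\in N_P^i$ the expression $P(b_1,\dots,b_m)$, obtained by substituting $b_i$ for every free occurrence of $x_i$, is a sentence of the language. If $P$ is a predicate with arity $m\ge1$, then all sentences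 $q_1x_1\dots q_mx_mP(x_1,\dots,x_m)$, each $q_i$ being $\forall$ or $\exists$, are in the language, and $\neg P$ is also a predicate with arity $m$ and domain $D_P$. Classical truth rules: sentences are so valuated as true or as false that $A$ is true iff $\neg A$ is false, and $A$ is false iff $\neg A$ is true; $A\vee B$ is true iff $A$ or $B$ is true, and false iff both are false; $A\wedge B$ is true iff both are true, and false iff $A$ or $B$ is false; $A\rightarrow B$ is true iff $A$ is false or $B$ is true, and false iff $A$ is true and $B$ is false; $A\leftrightarrow B$ is true iff $A,B$ are both true or both false, and false iff one is true and the other false; for a predicate $P$ with arity $m$, $q_1x_1\dots q_mx_mP(x_1,\dots,x_m)$ is true iff $P(b_1,\dots,b_m)$ is true for all $b_i\in N_P^i$ when $q_i$ is $\forall$, and for some $b_i\in N_P^i$ when $q_i$ is $\exists$; it is false iff $P(b_1,\dots,b_m)$ is false for all $b_i\in N_P^i$ when $q_i$ is $\exists$, and for some $b_i\in N_P^i$ when $q_i$ is $\forall$. Bivalence: every sentence of the language is either true or false. TRUTH. A truth predicate of a language is a predicate $T$ such that $T(\lceil A\rceil)\leftrightarrow A$ is true for every sentence $A$ of the language, where the term $\lceil A\rceil$ names $A$. A language has a theory of truth if truth values are assigned to its sentences and it contains a truth predicate; the theory is semantical if truth values of sentences are determined by their meanings. ''$\neg T$ is a non-truth predicate'' means that $\neg T(\lceil A\rceil)\leftrightarrow A$ is false for every sentence $A$ of the language. VALUATION BY MEANINGS. A sentence may be true by its meaning and may be false by its meaning. Standard meanings of logical symbols mean that the clauses in the classical truth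 rules hold with ''true/false'' read as ''true/false by its meaning'' (quantifiers ranging over the terms in the sets $N_P^i$ of the predicate concerned, and over $N_T$ for the predicates $T$, $\neg T$ and $T_1(\lceil T_2(\dot x)\rceil)$). The stipulated meaning of $T(\mathbf n)$ gives: $T(\lceil A\rceil)$ is true by its meaning iff $A$ is, and false by its meaning iff $A$ is. THE BASIC EXTENSION $L$ OF $L_0$. $L_1$ is formed by adding to $L_0$ those of the sentences $\neg A$, $A\vee B$, $A\wedge B$, $A\rightarrow B$, $A\leftrightarrow B$ and $q_1x_1\dots q_mx_mP(x_1,\dots,x_m)$ not already in $L_0$, where $A,B$ range over sentences of $L_0$, $P$ over its predicates and their negations (added if necessary), and each $q_i$ is $\forall$ or $\exists$; terms are added to name objects of $D$ without names. For $n\ge1$, $L_{n+1}$ is formed by adding to $L_n$ the sentences $\neg A$, $A\vee B$, $A\wedge B$, $A\rightarrow B$, $A\leftrightarrow B$ for $A,B$ in $L_n$. $L=\bigcup_{n\in\mathbb N_0}L_n$, with its sentences valuated by their meanings; $L$ has the closure property, satisfies the classical truth rules and is bivalent. CONSTRUCTION. The language $L_T$ (distinct from $\mathcal L_T$ below) is formed by adding to $L$ extra formulas $T(x)$, $\neg T(x)$ and sentences $T(\mathbf n)$, $\neg T(\mathbf n)$ for all numerals $\mathbf n$ of numbers $n\in\mathbb N_0=\{0,1,2,\dots\}$ (numerals are added to the terms if necessary). Fix a Gödel numbering of sentences; $\#A$ is the Gödel number of $A$ and $\lceil A\rceil$ is the numeral of $\#A$. For each predicate $P$ of $L$ with arity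 $m$ add the predicates $T(\lceil P(\dot x_1,\dots,\dot x_m)\rceil)$ and $\neg T(\lceil P(\dot x_1,\dots,\dot x_m)\rceil)$ with domain $D_P$, whose sentences at $(b_1,\dots,b_m)\in N_P$ are $T(\lceil P(b_1,\dots,b_m)\rceil)$ and $\neg T(\lceil P(b_1,\dots,b_m)\rceil)$; similarly the sentence of $T_1(\lceil T_2(\dot x)\rceil)$ at $\mathbf n$ is $T_1(\lceil T_2(\mathbf n)\rceil)$. Adding the sentences $\forall xT_1(x)$, $\exists xT_1(x)$, $\forall xT_1(\lceil T_2(\dot x)\rceil)$, $\exists xT_1(\lceil T_2(\dot x)\rceil)$ for $T_1,T_2\in\{T,\neg T\}$, and $q_1x_1\dots q_mx_mT(\lceil P(\dot x_1,\dots,\dot x_m)\rceil)$, $q_1x_1\dots q_mx_m\neg T(\lceil P(\dot x_1,\dots,\dot x_m)\rceil)$ for each predicate $P$ of $L$ with arity $m\ge1$ and all $q_i\in\{\forall,\exists\}$, gives a language $\mathcal L_0$. $\mathcal L_{n+1}$ is obtained from $\mathcal L_n$ by adding $\neg A$, $A\vee B$, $A\wedge B$, $A\rightarrow B$, $A\leftrightarrow B$ for all sentences $A,B$ of $\mathcal L_n$; $\mathcal L=\bigcup_n\mathcal L_n$. The Gödel numbering is extended to $\mathcal L$, and $\mathcal D$ is the set of Gödel numbers of sentences of $\mathcal L$. Let $\mathcal P^m$ be the set of predicates of $L$ with arity $m$ and $\mathcal P=\bigcup_{m\ge1}\mathcal P^m$. Put $Z=\{A: A$ is a true sentence of $L\}$;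 $Z_1(U)=\{T(\mathbf n):\mathbf n=\lceil A\rceil$, $A$ a sentence of $\mathcal L$, $\#A\in U\}$; $Z_2(U)=\{\neg T(\mathbf n):\mathbf n=\lceil A\rceil$, $A$ a sentence of $\mathcal L$, $\#[\neg A]\in U\}$; $Z_1=\{\neg\forall xT(x),\exists xT(x),\neg\forall x\neg T(x),\exists x\neg T(x)\}$; $Z_2=\{\neg(\forall xT_1(\lceil T_2(\dot x)\rceil)),\ \exists xT_1(\lceil T_2(\dot x)\rceil): T_1,T_2\in\{T,\neg T\}\}$; $Z_3=\bigcup_m\{q_1x_1\dots q_mx_mT(\lceil P(\dot x_1,\dots,\dot x_m)\rceil): P\in\mathcal P^m,\ q_1x_1\dots q_mx_mP(x_1,\dots,x_m)$ is true$\}$; $Z_4=\bigcup_m\{q_1x_1\dots q_mx_m\neg T(\lceil P(\dot x_1,\dots,\dot x_m)\rceil): P\in\mathcal P^m,\ q_1x_1\dots q_mx_m\neg P(x_1,\dots,x_m)$ is true$\}$. Set $L_0(\emptyset)=Z$ and $L_0(U)=Z\cup Z_1(U)\cup Z_2(U)\cup Z_1\cup Z_2\cup Z_3\cup Z_4$ for nonempty proper subsets $U$ of $\mathcal D$. Given $L_n(U)$, with $A,B$ ranging over sentences of $\mathcal L$, $L_{n+1}(U)$ is $L_n(U)$ together with all: $\neg(\neg A)$ with $A\in L_n(U)$; $A\vee B$ with ($A$ and $B$) or ($A$ and $\neg B$) or ($\neg A$ and $B$) in $L_n(U)$; $A\wedge B$ with $A,B\in L_n(U)$; $A\rightarrow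 B$ with ($\neg A$ and $B$) or ($\neg A$ and $\neg B$) or ($A$ and $B$) in $L_n(U)$; $A\leftrightarrow B$ with ($A$ and $B$) or ($\neg A$ and $\neg B$) in $L_n(U)$; $\neg(A\vee B)$ with $\neg A,\neg B\in L_n(U)$; $\neg(A\wedge B)$ with ($\neg A$ and $B$) or ($\neg A$ and $\neg B$) or ($A$ and $\neg B$) in $L_n(U)$; $\neg(A\rightarrow B)$ with $A,\neg B\in L_n(U)$; $\neg(A\leftrightarrow B)$ with ($A$ and $\neg B$) or ($\neg A$ and $B$) in $L_n(U)$. Put $L(U)=\bigcup_{n\ge0}L_n(U)$, $G(U)=\{\#A: A\in L(U)\}$, $F(U)=\{A:\neg A\in L(U)\}$. A subset $U$ of $\mathcal D$ is consistent if for no sentence $A$ of $\mathcal L$ both $\#A$ and $\#[\neg A]$ are in $U$. A smallest (with respect to inclusion) consistent $U\subset\mathcal D$ with $U=G(U)$ exists. THE LANGUAGE $\mathcal L_T$. Let $U$ be that smallest set. $\mathcal L_T$ is formed by $L_0$, the predicates of $\mathcal P$, the sentences of $L(U)$ and $F(U)$, the formulas $T(x)$, $\neg T(x)$ with corresponding predicates $T$, $\neg T$ having domain $D_T=L(U)\cup F(U)$ and set of terms $N_T=\{\mathbf n:\mathbf n=\lceil A\rceil$, $A\in D_T\}$, and the predicates $T_1(\lceil T_2(\dot x)\rceil)$ and $T_1(\lceil P(\dot x_1,\dots,\dot x_m)\rceil)$, where $T_1,T_2\in\{T,\neg T\}$ and $P\in\mathcal P$ has arity $m\ge1$.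
   Formalization: The negation of q₁x₁…qₘxₘT₁(⌈P⌉) is read as the dual sentence with ¬T₁, and the negation of ¬P as P, since otherwise false sentences ∀xT(⌈P⌉) lie in neither L(U) nor F(U) and closure fails; all objects of D are taken as named. *)

(* Defs.v *)
From mathcomp Require Import all_boot.

Set Implicit Arguments.
Unset Strict Implicit.
Unset Printing Implicit Defensive.

Inductive quantifier := All | Ex.

Definition dual (q : quantifier) : quantifier :=
  if q is All then Ex else All.

(* One universe of expressions contains the languages L_0, L and scriptL, so
   that adding a sentence which is already there is literally a no-op.
   In all four constructors the first boolean says whether the predicate is
   negated, i.e. whether T_1 is T ([false]) or ~T ([true]):
     PF b f      f(x_1,...,x_m) or ~f(x_1,...,x_m), for a formula f of L_0
     PT b        T_1(x)
     PTT b c     T_1(<T_2(x)>)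
     PTP b c f   T_1(<P(x_1,...,x_m)>), where P is PF c f
   As only T and ~T are available, the negation of ~P is read as P. *)
Inductive predicate (form : Type) :=
| PF of bool & form
| PT of bool
| PTT of bool & bool
| PTP of bool & bool & form.
Arguments PT {form} _.
Arguments PTT {form} _ _.

Definition notP (form : Type) (P : predicate form) : predicate form :=
  match P with
  | PF b f => PF (~~ b) f
  | PT b => PT (~~ b)
  | PTT b c => PTT (~~ b) c
  | PTP b c f => PTP (~~ b) c f
  end.

(* [Atom] covers every sentence of L_0 which is not built with a logical
   symbol; [Quant [:: q_1; ...; q_m] P] is q_1 x_1 ... q_m x_m P(x_1,...,x_m);
   [Tr t] is T(t). *)
Inductive expression (atom form term : Type) :=
| Atom of atom
| Neg of expression atom form term
| Or of expression atom form term & expression atom form term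
| And of expression atom form term & expression atom form term
| Imp of expression atom form term & expression atom form term
| Iff of expression atom form term & expression atom form term
| Quant of seq quantifier & predicate form
| Tr of term.

(* [subst f [:: b_1; ...; b_m]] is f(b_1,...,b_m). *)
Record syntax := Syntax {
  atom : countType;
  form : countType;
  term : countType;
  numeral : nat -> term;
  numeral_inj : injective numeral;
  subst : form -> seq term -> expression atom form term }.

Definition expr (S : syntax) := expression (atom S) (form S) (term S).
Definition pred_of (S : syntax) := predicate (form S).

(* The negation of q_1 x_1 ... q_m x_m T_1(<P>) is the dual sentence
   q'_1 x_1 ... q'_m x_m ~T_1(<P>). The sets Z_3 and Z_4 below contain exactly
   one sentence of each such dual pair and no other negation of these
   sentences: with [Neg] here, those for which q_1 x_1 ... q_m x_m P is false
   would belong neither to L(U) nor to F(U). All other negations are free. *)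
Definition Not (S : syntax) (A : expr S) : expr S :=
  match A with
  | Quant qs (PTP b c f) => Quant _ _ (map dual qs) (PTP (~~ b) c f)
  | _ => Neg A
  end.

Fixpoint T_free (S : syntax) (A : expr S) : Prop :=
  match A with
  | Atom _ => True
  | Neg B => @T_free S B
  | Or B C | And B C | Imp B C | Iff B C => @T_free S B /\ @T_free S C
  | Quant _ (PF _ _) => True
  | Quant _ _ => False
  | Tr _ => False
  end.

(* The term <A>: the numeral of the number of A under the numbering g. *)
Definition quote (S : syntax) (g : expr S -> nat) (A : expr S) : term S :=
  numeral S (g A).

Definition Tlit (S : syntax) (b : bool) (t : term S) : expr S :=
  if b then Not (Tr _ _ t : expr S) else Tr _ _ t.

(* The sentence P(b_1,...,b_m). *)
Definition inst (S : syntax) (g : expr S -> nat) (P : pred_of S)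
    (bs : seq (term S)) : expr S :=
  let Pf c f := if c then Not (subst f bs : expr S) else subst f bs in
  let t := head (numeral S 0) bs in
  match P with
  | PF c f => Pf c f
  | PT b => Tlit b t
  | PTT b c => Tlit b (quote g (Tlit c t))
  | PTP b c f => Tlit b (quote g (Pf c f))
  end.

(* [object] is the domain of discourse D, and [domain L P] lists the sets
   D_P^1, ..., D_P^m. *)
Record language (S : syntax) := Language {
  sentence : expr S -> Prop;
  predic : pred_of S -> Prop;
  object : Type;
  names : term S -> object -> Prop;
  domain : pred_of S -> seq (object -> Prop) }.

Definition arity (S : syntax) (L : language S) (P : pred_of S) : nat :=
  size (domain L P).

(* The sets N_P^1, ..., N_P^m. *)
Definition namesets (S : syntax) (L : language S) (P : pred_of S) :
    seq (term S -> Prop) :=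
  [seq (fun t => exists d, D d /\ names t d) | D <- domain L P].

Fixpoint in_product (T : Type) (Ns : seq (T -> Prop)) (bs : seq T) : Prop :=
  match Ns, bs with
  | [::], [::] => True
  | N :: Ns', b :: bs' => N b /\ in_product Ns' bs'
  | _, _ => False
  end.

Definition all_named (S : syntax) (L : language S) : Prop :=
  forall d : object L, exists t, names t d.

Definition is_predicate (S : syntax) (g : expr S -> nat) (L : language S)
    (P : pred_of S) : Prop :=
  [/\ predic L P, 0 < arity L P, all_named L &
      forall bs, in_product (namesets L P) bs -> sentence L (inst g P bs)].

(* A language in which T does not occur. A formula of the form ~f is [PF true f]
   only if f is itself a predicate of the language, and is otherwise a [form]
   of its own. *)
Definition is_base_language (S : syntax) (g : expr S -> nat)
    (L0 : language S) : Prop :=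
  [/\ exists A, sentence L0 A,
      all_named L0,
      forall A, sentence L0 A -> T_free A,
      forall P, predic L0 P ->
        (exists b f, P = PF b f) /\ is_predicate g L0 P
    & forall f, predic L0 (PF true f) ->
        predic L0 (PF false f) /\
        domain L0 (PF true f) = domain L0 (PF false f)].

Definition closure_property (S : syntax) (g : expr S -> nat)
    (L : language S) : Prop :=
  (forall A, sentence L A -> sentence L (Not A)) /\
  (forall A B, sentence L A -> sentence L B ->
     [/\ sentence L (Or A B), sentence L (And A B),
         sentence L (Imp A B) & sentence L (Iff A B)]) /\
  (forall P, predic L P ->
     [/\ is_predicate g L P,
         forall qs, size qs = arity L P -> sentence L (Quant _ _ qs P),
         is_predicate g L (notP P)
       & domain L (notP P) = domain L P]).

Record valuation (S : syntax) := Valuation {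
  is_tr : expr S -> Prop;
  is_fa : expr S -> Prop }.

Definition agree_on (S : syntax) (X : expr S -> Prop)
    (V W : valuation S) : Prop :=
  forall A, X A -> (is_tr V A <-> is_tr W A) /\ (is_fa V A <-> is_fa W A).

Definition bivalent (S : syntax) (L : language S) (V : valuation S) : Prop :=
  forall A, sentence L A ->
    (is_tr V A /\ ~ is_fa V A) \/ (is_fa V A /\ ~ is_tr V A).

(* The quantifiers are nested in the order q_1, ..., q_m; the falsity clause
   below is the nested condition for the dual prefix. *)
Fixpoint qholds (T : Type) (qs : seq quantifier) (Ns : seq (T -> Prop))
    (F : seq T -> Prop) : Prop :=
  match qs, Ns with
  | All :: qs', N :: Ns' =>
      forall b, N b -> qholds qs' Ns' (fun bs => F (b :: bs))
  | Ex :: qs', N :: Ns' =>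
      exists b, N b /\ qholds qs' Ns' (fun bs => F (b :: bs))
  | _, _ => F [::]
  end.

Definition classical_truth_rules (S : syntax) (g : expr S -> nat)
    (L : language S) (V : valuation S) : Prop :=
  let tr := is_tr V in let fa := is_fa V in
  (forall A, sentence L A ->
     (tr A <-> fa (Not A)) /\ (fa A <-> tr (Not A))) /\
  (forall A B, sentence L A -> sentence L B ->
     [/\ (tr (Or A B) <-> tr A \/ tr B) /\
         (fa (Or A B) <-> fa A /\ fa B),
         (tr (And A B) <-> tr A /\ tr B) /\
         (fa (And A B) <-> fa A \/ fa B),
         (tr (Imp A B) <-> fa A \/ tr B) /\
         (fa (Imp A B) <-> tr A /\ fa B)
       & (tr (Iff A B) <-> (tr A /\ tr B) \/ (fa A /\ fa B)) /\
         (fa (Iff A B) <-> (tr A /\ fa B) \/ (fa A /\ tr B))]) /\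
  (forall P qs, predic L P -> size qs = arity L P ->
     (tr (Quant _ _ qs P) <->
        qholds qs (namesets L P) (fun bs => tr (inst g P bs))) /\
     (fa (Quant _ _ qs P) <->
        qholds (map dual qs) (namesets L P) (fun bs => fa (inst g P bs)))).

Definition truth_predicate (S : syntax) (g : expr S -> nat) (L : language S)
    (V : valuation S) (P : pred_of S) : Prop :=
  [/\ is_predicate g L P, arity L P = 1 &
      forall A, sentence L A ->
        let PA := inst g P [:: quote g A] in
        [/\ in_product (namesets L P) [:: quote g A],
            sentence L (Iff PA A) & is_tr V (Iff PA A)]].

Definition non_truth_predicate (S : syntax) (g : expr S -> nat)
    (L : language S) (V : valuation S) (P : pred_of S) : Prop :=
  [/\ is_predicate g L P, arity L P = 1 &
      forall A, sentence L A ->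
        let PA := inst g P [:: quote g A] in
        [/\ in_product (namesets L P) [:: quote g A],
            sentence L (Iff PA A) & is_fa V (Iff PA A)]].

Definition has_theory_of_truth (S : syntax) (g : expr S -> nat)
    (L : language S) (V : valuation S) : Prop :=
  bivalent L V /\ exists P, truth_predicate g L V P.

(* [M] is the class of the valuations by meanings. *)
Definition has_semantical_theory_of_truth (S : syntax) (g : expr S -> nat)
    (L : language S) (M : valuation S -> Prop) (V : valuation S) : Prop :=
  [/\ has_theory_of_truth g L V, M V &
      forall W, M W -> agree_on (sentence L) V W].

Inductive compound (S : syntax) (X : expr S -> Prop) : expr S -> Prop :=
| compound_Not A : X A -> compound X (Not A)
| compound_Or A B : X A -> X B -> compound X (Or A B)
| compound_And A B : X A -> X B -> compound X (And A B)
| compound_Imp A B : X A -> X B -> compound X (Imp A B)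
| compound_Iff A B : X A -> X B -> compound X (Iff A B).

Fixpoint compound_level (S : syntax) (X : expr S -> Prop) (n : nat) :
    expr S -> Prop :=
  if n is k.+1 then
    fun C => compound_level X k C \/ compound (compound_level X k) C
  else X.

Definition ext_predic (S : syntax) (L0 : language S) (P : pred_of S) : Prop :=
  predic L0 P \/ predic L0 (notP P).

(* The domain of a negated predicate is that of the predicate. *)
Definition ext_domain (S : syntax) (L0 : language S) (P : pred_of S) :
    seq (object L0 -> Prop) :=
  if P is PF _ f then domain L0 (PF false f) else [::].

(* The sentences of L_1. *)
Definition ext_sentence1 (S : syntax) (L0 : language S) (C : expr S) : Prop :=
  [\/ sentence L0 C, compound (sentence L0) C |
      exists qs P, [/\ ext_predic L0 P, size qs = size (ext_domain L0 P)
                     & C = Quant _ _ qs P]].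

Definition basic_extension (S : syntax) (L0 : language S) : language S :=
  {| sentence := fun A => exists n, compound_level (ext_sentence1 L0) n A;
     predic := ext_predic L0;
     object := object L0;
     names := @names S L0;
     domain := ext_domain L0 |}.

Inductive script_level0 (S : syntax) (L0 : language S) : expr S -> Prop :=
| script_L A : sentence (basic_extension L0) A -> script_level0 L0 A
| script_T b n : script_level0 L0 (Tlit b (numeral S n))
| script_QT q b : script_level0 L0 (Quant _ _ [:: q] (PT b))
| script_QTT q b c : script_level0 L0 (Quant _ _ [:: q] (PTT b c))
| script_QTP qs b c f :
    predic (basic_extension L0) (PF c f) ->
    size qs = arity (basic_extension L0) (PF c f) ->
    script_level0 L0 (Quant _ _ qs (PTP b c f)).

Definition scriptL (S : syntax) (L0 : language S) (A : expr S) : Prop :=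
  exists n, compound_level (script_level0 L0) n A.

Definition godel_numbering (S : syntax) (L0 : language S)
    (g : expr S -> nat) : Prop :=
  forall A B, scriptL L0 A -> scriptL L0 B -> g A = g B -> A = B.

Definition scriptD (S : syntax) (L0 : language S) (g : expr S -> nat)
    (n : nat) : Prop :=
  exists A, scriptL L0 A /\ n = g A.

Definition Z (S : syntax) (L0 : language S) (V : valuation S) (A : expr S) :
    Prop :=
  sentence (basic_extension L0) A /\ is_tr V A.

Definition Z1U (S : syntax) (L0 : language S) (g : expr S -> nat)
    (U : nat -> Prop) (C : expr S) : Prop :=
  exists A, [/\ scriptL L0 A, U (g A) & C = Tr _ _ (quote g A)].

Definition Z2U (S : syntax) (L0 : language S) (g : expr S -> nat)
    (U : nat -> Prop) (C : expr S) : Prop :=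
  exists A, [/\ scriptL L0 A, U (g (Not A))
              & C = Not (Tr _ _ (quote g A) : expr S)].

Definition Z1 (S : syntax) (C : expr S) : Prop :=
  exists b, C = Not (Quant _ _ [:: All] (PT b) : expr S) \/
            C = Quant _ _ [:: Ex] (PT b).

Definition Z2 (S : syntax) (C : expr S) : Prop :=
  exists b c, C = Not (Quant _ _ [:: All] (PTT b c) : expr S) \/
              C = Quant _ _ [:: Ex] (PTT b c).

Definition Z3 (S : syntax) (L0 : language S) (V : valuation S) (C : expr S) :
    Prop :=
  let L := basic_extension L0 in
  exists qs c f,
    [/\ predic L (PF c f), size qs = arity L (PF c f),
        is_tr V (Quant _ _ qs (PF c f))
      & C = Quant _ _ qs (PTP false c f)].

Definition Z4 (S : syntax) (L0 : language S) (V : valuation S) (C : expr S) :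
    Prop :=
  let L := basic_extension L0 in
  exists qs c f,
    [/\ predic L (PF c f), size qs = arity L (PF c f),
        is_tr V (Quant _ _ qs (notP (PF c f)))
      & C = Quant _ _ qs (PTP true c f)].

(* U = D needs no separate case: only consistent sets U are considered. *)
Definition LU0 (S : syntax) (L0 : language S) (V : valuation S)
    (g : expr S -> nat) (U : nat -> Prop) (C : expr S) : Prop :=
  Z L0 V C \/
  (exists u, U u) /\
    (Z1U L0 g U C \/ Z2U L0 g U C \/ Z1 C \/ Z2 C \/ Z3 L0 V C \/ Z4 L0 V C).

Inductive LU_step (S : syntax) (L0 : language S) (X : expr S -> Prop) :
    expr S -> Prop :=
| step_NotNot A : scriptL L0 A -> X A -> LU_step L0 X (Not (Not A))
| step_Or A B : scriptL L0 A -> scriptL L0 B ->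
    [\/ X A /\ X B, X A /\ X (Not B) | X (Not A) /\ X B] ->
    LU_step L0 X (Or A B)
| step_And A B : scriptL L0 A -> scriptL L0 B ->
    X A /\ X B ->
    LU_step L0 X (And A B)
| step_Imp A B : scriptL L0 A -> scriptL L0 B ->
    [\/ X (Not A) /\ X B, X (Not A) /\ X (Not B) | X A /\ X B] ->
    LU_step L0 X (Imp A B)
| step_Iff A B : scriptL L0 A -> scriptL L0 B ->
    (X A /\ X B) \/ (X (Not A) /\ X (Not B)) ->
    LU_step L0 X (Iff A B)
| step_NotOr A B : scriptL L0 A -> scriptL L0 B ->
    X (Not A) /\ X (Not B) ->
    LU_step L0 X (Not (Or A B : expr S))
| step_NotAnd A B : scriptL L0 A -> scriptL L0 B ->
    [\/ X (Not A) /\ X B, X (Not A) /\ X (Not B) | X A /\ X (Not B)] ->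
    LU_step L0 X (Not (And A B : expr S))
| step_NotImp A B : scriptL L0 A -> scriptL L0 B ->
    X A /\ X (Not B) ->
    LU_step L0 X (Not (Imp A B : expr S))
| step_NotIff A B : scriptL L0 A -> scriptL L0 B ->
    (X A /\ X (Not B)) \/ (X (Not A) /\ X B) ->
    LU_step L0 X (Not (Iff A B : expr S)).

Fixpoint LU_level (S : syntax) (L0 : language S) (V : valuation S)
    (g : expr S -> nat) (U : nat -> Prop) (n : nat) : expr S -> Prop :=
  if n is k.+1 then
    fun C => LU_level L0 V g U k C \/ LU_step L0 (LU_level L0 V g U k) C
  else LU0 L0 V g U.

Definition LU (S : syntax) (L0 : language S) (V : valuation S)
    (g : expr S -> nat) (U : nat -> Prop) (A : expr S) : Prop :=
  exists n, LU_level L0 V g U n A.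

Definition GU (S : syntax) (L0 : language S) (V : valuation S)
    (g : expr S -> nat) (U : nat -> Prop) (n : nat) : Prop :=
  exists A, LU L0 V g U A /\ n = g A.

(* As in the formation rules, A ranges over the sentences of scriptL. *)
Definition FU (S : syntax) (L0 : language S) (V : valuation S)
    (g : expr S -> nat) (U : nat -> Prop) (A : expr S) : Prop :=
  scriptL L0 A /\ LU L0 V g U (Not A).

Definition consistent (S : syntax) (L0 : language S) (g : expr S -> nat)
    (U : nat -> Prop) : Prop :=
  forall A, scriptL L0 A -> ~ (U (g A) /\ U (g (Not A))).

Definition consistent_fixpoint (S : syntax) (L0 : language S)
    (V : valuation S) (g : expr S -> nat) (U : nat -> Prop) : Prop :=
  [/\ forall n, U n -> scriptD L0 g n, consistent L0 g U
    & forall n, U n <-> GU L0 V g U n].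

Definition smallest_consistent_fixpoint (S : syntax) (L0 : language S)
    (V : valuation S) (g : expr S -> nat) (U : nat -> Prop) : Prop :=
  consistent_fixpoint L0 V g U /\
  forall U', consistent_fixpoint L0 V g U' -> forall n, U n -> U' n.

(* The language L_T. Its domain of discourse consists of the objects of L_0 and
   of the sentences in D_T, a sentence A being named by the numeral <A>. The
   sentences of L_0 need no separate mention: they belong to L, hence to the
   union of L(U) and F(U). *)
Definition truth_language (S : syntax) (L0 : language S) (V : valuation S)
    (g : expr S -> nat) (U : nat -> Prop) : language S :=
  let DT := fun A => LU L0 V g U A \/ FU L0 V g U A in
  let L := basic_extension L0 in
  let lift (D : object L -> Prop) (o : object L + {A : expr S | DT A}) :=
    if o is inl d then D d else False in
  {| sentence := DT;
     predic := fun P => match P with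
                        | PF _ _ => predic L P
                        | PTP _ c f => predic L (PF c f)
                        | PT _ | PTT _ _ => True
                        end;
     object := (object L + {A : expr S | DT A})%type;
     names := fun t o => match o with
                         | inl d => names (l := L) t d
                         | inr A => t = quote g (sval A)
                         end;
     domain := fun P =>
       match P with
       | PF c f | PTP _ c f => map lift (domain L (PF c f))
       | PT _ | PTT _ _ =>
           [:: fun o => if o is inr _ then True else False]
       end |}.

(* T(<A>) is true (false) by its meaning iff A is. *)
Definition T_meaning (S : syntax) (g : expr S -> nat) (L : language S)
    (W : valuation S) : Prop :=
  forall A, sentence L A ->
    (is_tr W (Tr _ _ (quote g A)) <-> is_tr W A) /\
    (is_fa W (Tr _ _ (quote g A)) <-> is_fa W A).

(* W gives the truth values by meanings in an extension LT of L_0, where V gives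
   those of the sentences of L_0: the logical symbols have their standard
   meanings, and T has its stipulated one. *)
Definition by_meanings (S : syntax) (g : expr S -> nat) (L0 LT : language S)
    (V W : valuation S) : Prop :=
  [/\ agree_on (sentence L0) V W,
      classical_truth_rules g LT W & T_meaning g LT W].

(* Main.v *)
Require Import Defs.
From mathcomp Require Import all_boot.
From Stdlib Require Import Classical FunctionalExtensionality PropExtensionality.

(** The valuation that makes a sentence of the truth language true iff it is in
    L(U) and false iff it is in F(U) is called [LUFU] here. The theorem follows
    from two facts: [LUFU] is a valuation by meanings, and every valuation by
    meanings agrees with it on the truth language.

    The first fact is an argument by totality. The sentences of the truth
    language are by definition those in L(U) or F(U), and the consistency of U
    makes these two sets disjoint, so each sentence has exactly one truth value
    under [LUFU]. For such a valuation a truth rule, which is a pair of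
    equivalences, holds as soon as the compound sentence gets the value computed
    from the values of its parts: the converse implications come for free. So
    the formation rules of L(U) are only ever used forwards, to put a sentence
    into L(U), and never have to be inverted. Negation and the connectives are
    the nine steps of the construction; T(<A>) is the equation U = G(U); a
    quantified T-sentence over a predicate P of L is in L(U) or F(U) according
    to the truth value of the same quantified sentence about P in L
    ([LUFU_value_QTP]), where the language is already bivalent ([ext_bivalent]); a
    quantified sentence over T_1(x) or T_1(<T_2(x)>) is true if existential and false if universal, because
    true and false sentences both exist ([quantifier_rule_mixed]).

    For the second fact it is enough that the members of L(U) are true, and not
    false, in every valuation W by meanings ([LU_true]): then those of F(U) are
    false and not true by the rule for negation. On L this is an induction on the
    formation of sentences ([ext_agree]). Beyond L it cannot be an induction on
    the formation of A, since T(<A>) is atomic and A is arbitrary; instead U is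
    the least fixed point of G, and the argument is induction on that fixed
    point. Minimality of U is given among consistent fixed points only; but the
    intersection of all G-closed sets is, G being monotone, a fixed point
    contained in U, hence consistent, hence equal to U
    ([smallest_consistent_fixpoint_ind]). *)

Set Implicit Arguments.
Unset Strict Implicit.
Unset Printing Implicit Defensive.

Lemma predext (T : Type) (F G : T -> Prop) : (forall t, F t <-> G t) -> F = G.
Proof.
move=> FG; apply: functional_extensionality => t.
exact: propositional_extensionality.
Qed.

(** * Closure of a set of sentences under the connectives *)

Section Compounds.
Variable S : syntax.
Implicit Types (X Y : expr S -> Prop) (A B C : expr S).

Definition generated X A := exists n, compound_level X n A.

Lemma compound_sub X Y C :
  (forall A, X A -> Y A) -> compound X C -> compound Y C.
Proof. by move=> XY [] *; constructor; apply: XY. Qed.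

Lemma compound_level_le X m n A :
  m <= n -> compound_level X m A -> compound_level X n A.
Proof.
move=> /subnK <-; elim: (n - m) => [//|k IH] /IH h.
by rewrite addSn; left.
Qed.

Lemma generated_base X A : X A -> generated X A.
Proof. by move=> XA; exists 0. Qed.

Lemma generated_compound X C : compound (generated X) C -> generated X C.
Proof.
have up m n A : compound_level X m A -> compound_level X (maxn m n) A.
  exact/compound_level_le/leq_maxl.
have up' m n A : compound_level X m A -> compound_level X (maxn n m) A.
  exact/compound_level_le/leq_maxr.
case=> [A [m hA]|A B [m hA] [n hB]|A B [m hA] [n hB]|A B [m hA] [n hB]
       |A B [m hA] [n hB]].
- by exists m.+1; right; constructor.
all: by exists (maxn m n).+1; right; constructor; [exact: up|exact: up'].
Qed.

(** Together with [generated_compound] this says that the union of the levels is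
    the least set containing [X] and closed under the connectives, so that later
    arguments need not mention levels. *)
Lemma generated_ind X (Q : expr S -> Prop) :
  (forall A, X A -> Q A) ->
  (forall C, compound (fun A => generated X A /\ Q A) C -> Q C) ->
  forall A, generated X A -> Q A.
Proof.
move=> base step A [n]; elim: n A => [//|n IH] A [/IH//|hA].
apply: step; apply: compound_sub hA => B hB.
by split; [exists n|exact: IH].
Qed.

End Compounds.

(** * Unambiguous truth values *)

Section Values.
Variable S : syntax.
Implicit Types (V W : valuation S) (L : language S) (A B C : expr S).

(** A [valuation] treats truth and falsity as unrelated predicates, so that
    having a value means one of them together with the failure of the other. *)
Definition value W A (v : bool) : Prop :=
  if v then is_tr W A /\ ~ is_fa W A else is_fa W A /\ ~ is_tr W A.

Definition same V A W B : Prop :=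
  (is_tr V A <-> is_tr W B) /\ (is_fa V A <-> is_fa W B).

Lemma value_same V A W B v : value V A v -> value W B v -> same V A W B.
Proof. by case: v => -[? ?] [? ?]; split; tauto. Qed.

Lemma same_value V A W B v : same V A W B -> value V A v -> value W B v.
Proof. by rewrite /value => -[? ?]; case: v; tauto. Qed.

Lemma same_sym V A W B : same V A W B -> same W B V A.
Proof. by case=> ? ?; split; tauto. Qed.

Lemma same_trans V A W B X C : same V A W B -> same W B X C -> same V A X C.
Proof. by move=> [? ?] [? ?]; split; tauto. Qed.

Lemma bivalentP L W :
  bivalent L W <-> forall A, sentence L A -> exists v, value W A v.
Proof.
split=> h A /h; first by case; [exists true|exists false].
by case=> -[] ?; [left|right].
Qed.

Definition Not_rule L W := forall A, sentence L A ->
  (is_tr W A <-> is_fa W (Not A)) /\ (is_fa W A <-> is_tr W (Not A)).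

Lemma value_Not L W A v : Not_rule L W -> sentence L A ->
  value W (Not A) v <-> value W A (~~ v).
Proof. by move=> hN /hN; rewrite /value => -[? ?]; case: v => /=; tauto. Qed.

Definition connective_rules W A B :=
  [/\ (is_tr W (Or A B) <-> is_tr W A \/ is_tr W B) /\
      (is_fa W (Or A B) <-> is_fa W A /\ is_fa W B),
      (is_tr W (And A B) <-> is_tr W A /\ is_tr W B) /\
      (is_fa W (And A B) <-> is_fa W A \/ is_fa W B),
      (is_tr W (Imp A B) <-> is_fa W A \/ is_tr W B) /\
      (is_fa W (Imp A B) <-> is_tr W A /\ is_fa W B)
    & (is_tr W (Iff A B) <->
         (is_tr W A /\ is_tr W B) \/ (is_fa W A /\ is_fa W B)) /\
      (is_fa W (Iff A B) <->
         (is_tr W A /\ is_fa W B) \/ (is_fa W A /\ is_tr W B))].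

(** For sentences with a definite value the eight equivalences are just the
    truth tables. This turns the verification of the rules into a computation of
    values, and conversely. *)
Lemma value_connectives W A B a b : value W A a -> value W B b ->
  connective_rules W A B <->
  [/\ value W (Or A B) (a || b), value W (And A B) (a && b),
      value W (Imp A B) (a ==> b) & value W (Iff A B) (a == b)].
Proof.
have and4_iff (P1 P2 P3 P4 Q1 Q2 Q3 Q4 : Prop) :
    (P1 <-> Q1) -> (P2 <-> Q2) -> (P3 <-> Q3) -> (P4 <-> Q4) ->
    ([/\ P1, P2, P3 & P4] <-> [/\ Q1, Q2, Q3 & Q4]).
  by move=> e1 e2 e3 e4; split=> -[/e1 ? /e2 ? /e3 ? /e4 ?].
rewrite /value; case: a => -[? ?]; case: b => -[? ?] /=.
all: by apply: and4_iff; split; tauto.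
Qed.

(** The rules determine the truth and the falsity of a compound from those of
    its parts, even if the parts should have no definite value; [X] carries what
    is known of the parts. *)
Lemma compound_same g V W L M X C :
  classical_truth_rules g L V -> classical_truth_rules g M W ->
  compound (fun A => [/\ X A, sentence L A, sentence M A & same V A W A]) C ->
  same V C W C.
Proof.
move=> [hNV [hcV _]] [hNW [hcW _]] [].
- move=> A [_ /hNV [? ?] /hNW [? ?] [? ?]]; split; tauto.
all: move=> A B [_ LA MA [? ?]] [_ LB MB [? ?]].
all: move: (hcV A B LA LB) (hcW A B MA MB).
- by case=> [[? ?] _ _ _] [[? ?] _ _ _]; split; tauto.
- by case=> [_ [? ?] _ _] [_ [? ?] _ _]; split; tauto.
- by case=> [_ _ [? ?] _] [_ _ [? ?] _]; split; tauto.
- by case=> [_ _ _ [? ?]] [_ _ _ [? ?]]; split; tauto.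
Qed.

Lemma value_compound g W L C :
  classical_truth_rules g L W ->
  compound (fun A => sentence L A /\ exists v, value W A v) C ->
  exists v, value W C v.
Proof.
move=> [hN [hC _]] [].
  move=> A [LA [v hv]]; exists (~~ v).
  by apply/(value_Not _ hN LA); rewrite negbK.
all: move=> A B [LA [a hA]] [LB [b hB]].
all: have [? ? ? ?] := (value_connectives hA hB).1 (hC A B LA LB).
all: by eexists; eassumption.
Qed.

End Values.

(** * Quantifier prefixes *)

Section Quantifiers.
Variable T : Type.
Implicit Types (qs : seq quantifier) (Ns : seq (T -> Prop)) (F G : seq T -> Prop).

Lemma qholds_congr qs Ns F G : size qs = size Ns ->
  (forall bs, in_product Ns bs -> (F bs <-> G bs)) ->
  (qholds qs Ns F <-> qholds qs Ns G).
Proof.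
elim: qs Ns F G => [|q qs IH] [|N Ns] F G //=; first by move=> _; apply.
move=> [] hs FG.
have step b : N b -> (qholds qs Ns (fun bs => F (b :: bs)) <->
                      qholds qs Ns (fun bs => G (b :: bs))).
  by move=> Nb; apply: IH => // bs hbs; apply: FG.
case: q; first by split=> h b Nb; apply/(step b Nb)/h.
by split=> -[b [Nb h]]; exists b; split=> //; apply/(step b Nb).
Qed.

(** De Morgan for prefixes; classical logic is needed to get a witness out of the
    failure of a universal condition. *)
Lemma qholds_dual qs Ns F G : size qs = size Ns ->
  (forall bs, in_product Ns bs -> (G bs <-> ~ F bs)) ->
  (qholds (map dual qs) Ns G <-> ~ qholds qs Ns F).
Proof.
elim: qs Ns F G => [|q qs IH] [|N Ns] F G //=; first by move=> _; apply.
move=> [] hs FG.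
have step b : N b -> (qholds (map dual qs) Ns (fun bs => G (b :: bs)) <->
                      ~ qholds qs Ns (fun bs => F (b :: bs))).
  by move=> Nb; apply: IH => // bs hbs; apply: FG.
case: q => /=; split.
- by move=> [b [Nb /(step b Nb) h]] /(_ b Nb).
- move=> h; apply: NNPP => h'; apply: h => b Nb; apply: NNPP => /(step b Nb) ?.
  by apply: h'; exists b.
- by move=> h [b [Nb]]; apply/(step b Nb)/h.
- by move=> h b Nb; apply/(step b Nb) => ?; apply: h; exists b.
Qed.

End Quantifiers.

(** * The truth rule for quantified sentences *)

Section QuantifierRule.
Variables (S : syntax) (g : expr S -> nat).
Implicit Types (V W : valuation S) (L M : language S) (P Q : pred_of S).

Definition quantifier_rule L W P qs :=
  (is_tr W (Quant _ _ qs P) <->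
     qholds qs (namesets L P) (fun bs => is_tr W (inst g P bs))) /\
  (is_fa W (Quant _ _ qs P) <->
     qholds (map dual qs) (namesets L P) (fun bs => is_fa W (inst g P bs))).

Lemma size_namesets L P : size (namesets L P) = arity L P.
Proof. exact: size_map. Qed.

(** Both sides of the rule depend only on the range of the quantifiers and on
    the values of the instances. Hence if [P] satisfies the rule in one language
    and [Q] has in another the same range and the same instance values, the rule
    for [Q] says that its quantified sentence has the value of that of [P]. Read
    from right to left this establishes the rule for [Q], read from left to right
    it computes a value from it. *)
Lemma quantifier_rule_transfer L M V W P Q qs :
  namesets M Q = namesets L P -> size qs = arity L P ->
  (forall bs, in_product (namesets L P) bs ->
     same V (inst g P bs) W (inst g Q bs)) ->
  quantifier_rule L V P qs ->
  (quantifier_rule M W Q qs <-> same V (Quant _ _ qs P) W (Quant _ _ qs Q)).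
Proof.
move=> hN; rewrite -size_namesets => hs hF [rT rF].
have eqT := qholds_congr hs (fun bs hbs => (hF bs hbs).1).
have hs' : size (map dual qs) = size (namesets L P) by rewrite size_map.
have eqF := qholds_congr hs' (fun bs hbs => (hF bs hbs).2).
by rewrite /quantifier_rule hN; split=> -[? ?]; split; tauto.
Qed.

Lemma quantifier_rule_bivalent L W P qs : size qs = arity L P ->
  (forall bs, in_product (namesets L P) bs ->
     exists v, value W (inst g P bs) v) ->
  quantifier_rule L W P qs -> exists v, value W (Quant _ _ qs P) v.
Proof.
rewrite -size_namesets => hs hF [rT rF].
have := @qholds_dual _ _ _ (fun bs => is_tr W (inst g P bs))
          (fun bs => is_fa W (inst g P bs)) hs.
case=> [bs /hF [[] [] ? ?]|dT dF]; [tauto|tauto|].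
case: (classic (is_tr W (Quant _ _ qs P))) => h; [exists true|exists false];
  rewrite /value; tauto.
Qed.

Definition is_Ex q := if q is Ex then true else false.

(** A unary predicate with a true and a false instance satisfies exactly the
    existential quantification. This is why no information on [U] enters the
    values of the quantified sentences over [T]. *)
Lemma quantifier_rule_mixed L W P q N t1 t2 :
  namesets L P = [:: N] -> N t1 -> N t2 ->
  value W (inst g P [:: t1]) true -> value W (inst g P [:: t2]) false ->
  (quantifier_rule L W P [:: q] <-> value W (Quant _ _ [:: q] P) (is_Ex q)).
Proof.
rewrite /quantifier_rule => -> N1 N2 [tr1 nfa1] [fa2 ntr2].
have exT : exists b, N b /\ is_tr W (inst g P [:: b]) by exists t1.
have exF : exists b, N b /\ is_fa W (inst g P [:: b]) by exists t2.
have nallT : ~ (forall b, N b -> is_tr W (inst g P [:: b])) by move/(_ _ N2).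
have nallF : ~ (forall b, N b -> is_fa W (inst g P [:: b])) by move/(_ _ N1).
by case: q; rewrite /value /=; tauto.
Qed.

End QuantifierRule.

(** * The basic extension of the base language *)

Section BasicExtension.
Variables (S : syntax) (g : expr S -> nat) (L0 : language S) (V : valuation S).
Hypothesis hL0 : is_base_language g L0.
Hypothesis hbiv : bivalent L0 V.
Hypothesis hlog : classical_truth_rules g (basic_extension L0) V.
Notation L := (basic_extension L0).

Lemma ext_predic_PF c f : predic L (PF c f) <-> predic L0 (PF false f).
Proof.
have [_ _ _ _ hneg] := hL0.
by split=> [[]|]; case: c => /=; rewrite /ext_predic /=; auto => /hneg[].
Qed.

Lemma ext_predic_sign c d f : predic L (PF c f) -> predic L (PF d f).
Proof. by move=> /ext_predic_PF ?; apply/ext_predic_PF. Qed.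

Lemma ext_predicP P : predic L P ->
  exists c f, P = PF c f /\ predic L (PF c f).
Proof.
have [_ _ _ hP _] := hL0; move=> LP.
suff [c [f E]] : exists c f, P = PF c f by exists c, f; rewrite -E.
case: LP => /hP [[b [f E]] _]; first by exists b, f.
by case: P E => // c f' _; exists c, f'.
Qed.

Lemma ext_arity_gt0 c f : predic L (PF c f) -> 0 < arity L (PF c f).
Proof. by move=> /ext_predic_PF; have [_ _ _ hP _] := hL0; case/hP=> _ []. Qed.

Lemma sentence_subst c f bs : predic L (PF c f) ->
  in_product (namesets L (PF c f)) bs -> sentence L0 (subst f bs).
Proof.
move=> /ext_predic_PF; have [_ _ _ hP _] := hL0.
by case/hP=> _ [_ _ _ h] /h.
Qed.

Lemma ext_base A : sentence L0 A -> sentence L A.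
Proof. by move=> hA; apply: generated_base; apply: Or31. Qed.

Lemma ext_compound C : compound (sentence L) C -> sentence L C.
Proof. exact: generated_compound. Qed.

Lemma ext_Not A : sentence L A -> sentence L (Not A).
Proof. by move=> ?; apply: ext_compound; constructor. Qed.

Lemma ext_Quant c f qs : predic L (PF c f) -> size qs = arity L (PF c f) ->
  sentence L (Quant _ _ qs (PF c f)).
Proof.
by move=> hP hs; apply: generated_base; apply: Or33; exists qs, (PF c f).
Qed.

Lemma ext_inst c f bs : predic L (PF c f) ->
  in_product (namesets L (PF c f)) bs -> sentence L (inst g (PF c f) bs).
Proof.
by move=> hP /(sentence_subst hP) /ext_base; case: c hP => //= _; apply: ext_Not.
Qed.

Lemma ext_bivalent A : sentence L A -> exists v, value V A v.
Proof.
have [hN [hC hQ]] := hlog; have b0 := (bivalentP L0 V).1 hbiv.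
have comp C := @value_compound _ _ _ _ C hlog.
move: A; apply: generated_ind => [A|C hC']; last exact: comp.
case=> [/b0//|hA|[qs [P [LP hs ->]]]].
  apply: comp; apply: compound_sub hA => B hB.
  by split; [exact: ext_base|exact: b0].
have [c [f [E LPF]]] := ext_predicP LP; rewrite E in LP hs *.
have := hQ _ _ LP hs; apply: quantifier_rule_bivalent => // bs hbs.
have LA := sentence_subst LPF hbs; have [v hv] := b0 _ LA.
case: c {E LP hs LPF hbs} => /=; last by exists v.
by exists (~~ v); apply/(value_Not _ hN (ext_base LA)); rewrite negbK.
Qed.

(** A sentence of the base language or its negation has the value [v]. *)
Lemma ext_value_ex v : exists A, sentence L A /\ value V A v.
Proof.
have [[A /ext_base LA] _ _ _ _] := hL0; have [w hw] := ext_bivalent LA.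
have [->|] := eqVneq v w; first by exists A.
move=> vw; exists (Not A); split; first exact: ext_Not.
apply/(value_Not _ hlog.1 LA).
by case: v w vw hw => -[].
Qed.

Lemma map_dualK : involutive (map dual).
Proof. by elim=> [//|[] qs /= ->]. Qed.

(** This brings the falsity of a quantified sentence over P into the form in
    which the sets Z_3 and Z_4 of the construction speak of it, namely as the
    truth of the dual sentence over the negation of P. *)
Lemma value_Quant_dual c f qs v :
  predic L (PF c f) -> size qs = arity L (PF c f) ->
  value V (Quant _ _ qs (PF c f)) v ->
  value V (Quant _ _ (map dual qs) (PF (~~ c) f)) (~~ v).
Proof.
move=> hP hs; have [hN [_ hQ]] := hlog.
have hP' := ext_predic_sign (~~ c) hP.
have [rT rF] := hQ _ _ hP hs.
have [|rT' rF'] := hQ _ (map dual qs) hP'; first by rewrite size_map.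
have hi bs : in_product (namesets L (PF c f)) bs ->
    (is_fa V (inst g (PF c f) bs) <-> is_tr V (inst g (PF (~~ c) f) bs)) /\
    (is_tr V (inst g (PF c f) bs) <-> is_fa V (inst g (PF (~~ c) f) bs)).
  move=> /(sentence_subst hP) /ext_base /hN [? ?].
  by case: (c) => /=; split; tauto.
rewrite -size_namesets in hs.
have eqT := qholds_congr hs (fun bs h => (hi bs h).2).
have hs' : size (map dual qs) = size (namesets L (PF c f)) by rewrite size_map.
have eqF := qholds_congr hs' (fun bs h => (hi bs h).1).
rewrite map_dualK in rF'.
have eN : namesets L (PF (~~ c) f) = namesets L (PF c f) by [].
rewrite eN in rT' rF'.
by rewrite /value; case: v => /=; tauto.
Qed.

(** The truth values in the basic extension are forced by those in the base
    language, because its sentences are built up by connectives and quantifiers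
    from sentences of the base language. *)
Lemma ext_agree M W :
  classical_truth_rules g M W -> agree_on (sentence L0) V W ->
  (forall A, sentence L A -> sentence M A) ->
  (forall c f, predic L (PF c f) -> predic M (PF c f) /\
     namesets M (PF c f) = namesets L (PF c f)) ->
  forall A, sentence L A -> same V A W A.
Proof.
move=> rW hVW sub hMP.
have comp C : compound (fun A => sentence L A /\ same V A W A) C -> same V C W C.
  move=> hC; apply: (compound_same (X := sentence L) hlog rW).
  by apply: compound_sub hC => A [LA ?]; split=> //; apply: sub.
apply: generated_ind => [A|C]; last exact: comp.
case=> [/hVW//|hA|[qs [P [LP hs ->]]]].
  apply: comp; apply: compound_sub hA => B hB.
  by split; [exact: ext_base|exact: hVW].
have [c [f [E LPF]]] := ext_predicP LP; rewrite E in LP hs *.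
have [hM eN] := hMP _ _ LPF.
have [_ [_ hQ]] := hlog; have [hN [_ hQW]] := rW.
apply/(quantifier_rule_transfer eN hs _ (hQ _ _ LPF hs)); last first.
  by apply: hQW => //; rewrite -size_namesets eN size_namesets.
move=> bs /(sentence_subst LPF) L0A; have := hVW _ L0A.
have /hlog.1 [? ?] := ext_base L0A; have /sub/hN [? ?] := ext_base L0A.
by case: (c) => //= -[? ?]; split; tauto.
Qed.

End BasicExtension.

(** * The sets L(U), and induction on the smallest U *)

Section Formation.
Variables (S : syntax) (g : expr S -> nat) (L0 : language S) (V : valuation S).
Implicit Types (U X : nat -> Prop).
Notation L := (basic_extension L0).
Notation LU := (LU L0 V g).

Lemma scriptL_compound C : compound (scriptL L0) C -> scriptL L0 C.
Proof. exact: generated_compound. Qed.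

Lemma scriptL_Not A : scriptL L0 A -> scriptL L0 (Not A).
Proof. by move=> ?; apply: scriptL_compound; constructor. Qed.

Lemma scriptL_base A : script_level0 L0 A -> scriptL L0 A.
Proof. exact: generated_base. Qed.

Lemma LU0_scriptL U A : LU0 L0 V g U A -> scriptL L0 A.
Proof.
case=> [[LA _]|[_]]; first by apply: scriptL_base; constructor.
case=> [[B [_ _ ->]]|]; first exact/scriptL_base/(script_T _ false).
case=> [[B [_ _ ->]]|]; first exact/scriptL_base/(script_T _ true).
case=> [[b [->|->]]|].
- exact/scriptL_Not/scriptL_base/script_QT.
- exact/scriptL_base/script_QT.
case=> [[b [c [->|->]]]|].
- exact/scriptL_Not/scriptL_base/script_QTT.
- exact/scriptL_base/script_QTT.
by case=> -[qs [c [f [hP hs _ ->]]]]; apply/scriptL_base/script_QTP.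
Qed.

Lemma LU_step_scriptL (X : expr S -> Prop) A : LU_step L0 X A -> scriptL L0 A.
Proof.
by case=> *; do ?apply: scriptL_Not => //; apply: scriptL_compound; constructor.
Qed.

Lemma LU_scriptL U A : LU U A -> scriptL L0 A.
Proof.
case=> [[|n]]; first exact: LU0_scriptL.
elim: n A => [|n IH] A [|/LU_step_scriptL//]; first exact: LU0_scriptL.
exact: IH.
Qed.

Lemma LU_step_sub (X Y : expr S -> Prop) A :
  (forall B, X B -> Y B) -> LU_step L0 X A -> LU_step L0 Y A.
Proof. move=> XY [B sB /XY ?|B C sB sC h|B C sB sC h|B C sB sC h|B C sB sC h|B C sB sC h
       |B C sB sC h|B C sB sC h|B C sB sC h].
- exact: step_NotNot.
- by apply: step_Or => //; case: h => -[/XY ? /XY ?];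
    [apply: Or31|apply: Or32|apply: Or33].
- by case: h => /XY ? /XY ?; apply: step_And.
- by apply: step_Imp => //; case: h => -[/XY ? /XY ?];
    [apply: Or31|apply: Or32|apply: Or33].
- by apply: step_Iff => //; case: h => -[/XY ? /XY ?]; [left|right].
- by case: h => /XY ? /XY ?; apply: step_NotOr.
- by apply: step_NotAnd => //; case: h => -[/XY ? /XY ?];
    [apply: Or31|apply: Or32|apply: Or33].
- by case: h => /XY ? /XY ?; apply: step_NotImp.
- by apply: step_NotIff => //; case: h => -[/XY ? /XY ?]; [left|right].
Qed.

Lemma LU_level_le U m n A :
  m <= n -> LU_level L0 V g U m A -> LU_level L0 V g U n A.
Proof.
move=> /subnK <-; elim: (n - m) => [//|k IH] /IH h.
by rewrite addSn; left.
Qed.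

(** L(U) is closed under the formation steps because a step has at most two
    premises, which appear together at some finite level. *)
Lemma LU_of_step U A : LU_step L0 (LU U) A -> LU U A.
Proof.
have pair B C : LU U B -> LU U C ->
    exists n, LU_level L0 V g U n B /\ LU_level L0 V g U n C.
  move=> [m hB] [n hC]; exists (maxn m n).
  split; [apply: LU_level_le hB|apply: LU_level_le hC].
    exact: leq_maxl.
  exact: leq_maxr.
suff fin : LU_step L0 (LU U) A ->
    exists n, LU_step L0 (LU_level L0 V g U n) A.
  by move=> /fin [n hn]; exists n.+1; right.
have two B C : LU U B /\ LU U C ->
    exists n, LU_level L0 V g U n B /\ LU_level L0 V g U n C.
  by case; apply: pair.
case=> [B sB [n hB]|B C sB sC h|B C sB sC h|B C sB sC h|B C sB sC h|B C sB sC h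
       |B C sB sC h|B C sB sC h|B C sB sC h].
- by exists n; apply: step_NotNot.
- by case: h => /two [n hn]; exists n; apply: step_Or => //;
    [apply: Or31|apply: Or32|apply: Or33].
- by have [n hn] := two _ _ h; exists n; apply: step_And.
- by case: h => /two [n hn]; exists n; apply: step_Imp => //;
    [apply: Or31|apply: Or32|apply: Or33].
- by case: h => /two [n hn]; exists n; apply: step_Iff => //; [left|right].
- by have [n hn] := two _ _ h; exists n; apply: step_NotOr.
- by case: h => /two [n hn]; exists n; apply: step_NotAnd => //;
    [apply: Or31|apply: Or32|apply: Or33].
- by have [n hn] := two _ _ h; exists n; apply: step_NotImp.
- by case: h => /two [n hn]; exists n; apply: step_NotIff => //; [left|right].
Qed.

(** [U] occurs only positively in the construction of L(U). *)
Lemma LU_sub U X A : (forall n, U n -> X n) -> LU U A -> LU X A.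
Proof.
move=> UX [n hA]; exists n; elim: n A hA => [|n IH] A /=.
  case=> [|[[u Uu] hA]]; [by left|right; split; first by exists u; apply: UX].
  case: hA => [[B [? ? ->]]|]; first by left; exists B; split; auto.
  by case=> [[B [? ? ->]]|]; [right; left; exists B; split; auto|auto].
case=> [/IH|hA]; first by left.
by right; apply: LU_step_sub hA.
Qed.

Lemma GU_sub U X n : (forall n, U n -> X n) ->
  GU L0 V g U n -> GU L0 V g X n.
Proof. by move=> UX [A [hA ->]]; exists A; split=> //; apply: LU_sub hA. Qed.

(** Knaster-Tarski inside [U]: the intersection [I] of all G-closed sets is a
    fixed point of G and is contained in [U], so it inherits consistency from [U]
    and competes with [U] for minimality. The induction hypothesis keeps [U m],
    since the truth rules can be applied only to sentences known to belong to the
    truth language. *)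
Lemma smallest_consistent_fixpoint_ind U X :
  smallest_consistent_fixpoint L0 V g U ->
  (forall n, GU L0 V g (fun m => U m /\ X m) n -> X n) ->
  forall n, U n -> X n.
Proof.
move=> [[US Ucons UG] Umin] hX.
pose I n := forall Y, (forall m, GU L0 V g Y m -> Y m) -> Y n.
have I_sub Y : (forall m, GU L0 V g Y m -> Y m) -> forall n, I n -> Y n.
  by move=> hY n; apply.
have IU : forall n, I n -> U n by apply: I_sub => m /UG.
have GI n : GU L0 V g I n -> I n.
  move=> hn Y hY; apply/hY/(GU_sub (I_sub Y hY)) => //.
have fixI : consistent_fixpoint L0 V g I.
  split=> [n /IU/US//|A sA [/IU ? /IU ?]|n]; first exact: (Ucons A sA).
  split=> [|/GI//]; move: n; apply: I_sub => m; exact: GU_sub.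
move=> n /(Umin _ fixI).
suff: forall n, I n -> U n /\ X n by move=> h /h [].
apply: I_sub => m hm; split; last exact: hX.
by apply/UG; apply: GU_sub hm => k [].
Qed.

End Formation.

(** * L(U) and F(U) as the truth and the falsity of a valuation *)

Section TruthLanguage.
Variables (S : syntax) (L0 : language S) (V : valuation S).
Variables (g : expr S -> nat) (U : nat -> Prop).
Hypothesis hL0 : is_base_language g L0.
Hypothesis hbiv : bivalent L0 V.
Hypothesis hlog : classical_truth_rules g (basic_extension L0) V.
Hypothesis hg : godel_numbering L0 g.
Hypothesis hU : smallest_consistent_fixpoint L0 V g U.
Notation L := (basic_extension L0).
Notation LT := (truth_language L0 V g U).
Notation LU := (LU L0 V g U).
Notation FU := (FU L0 V g U).
Notation LUFU := (Valuation LU FU).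

(** Needs the fixed point equation and the injectivity of the numbering. *)
Lemma in_U A : scriptL L0 A -> (U (g A) <-> LU A).
Proof.
have [[_ _ UG] _] := hU; move=> sA; split=> [/UG [B [hB E]]|hA].
  by rewrite (hg sA (LU_scriptL hB) E).
by apply/UG; exists A.
Qed.

Lemma LU_consistent A : scriptL L0 A -> ~ (LU A /\ LU (Not A)).
Proof.
move=> sA [/(in_U sA) h /(in_U (scriptL_Not sA)) h'].
by have [[_ cons _] _] := hU; apply: (cons A sA).
Qed.

(** Consistency of [U] makes membership in one of the two sets a definite truth
    value. *)
Lemma LUFU_value A v : value LUFU A v <-> (if v then LU A else FU A).
Proof.
case: v => /=; split=> [[]//|h]; split=> //.
  by move=> [sA hN]; apply: (LU_consistent sA).
by case: h => sA hN ?; apply: (LU_consistent sA).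
Qed.

Lemma LUFU_value_ex A : sentence LT A -> exists v, value LUFU A v.
Proof. by case=> h; [exists true|exists false]; apply/LUFU_value. Qed.

Lemma LUFU_value_sentence A v : value LUFU A v -> sentence LT A.
Proof. by move/LUFU_value; case: v; [left|right]. Qed.

Lemma LUFU_value_scriptL A v : value LUFU A v -> scriptL L0 A.
Proof. by move/LUFU_value; case: v => [/LU_scriptL|[]]. Qed.

(** F(U) contains the false sentences of the basic extension since Z contains
    their negations. *)
Lemma LUFU_value_ext A v : sentence L A -> value V A v -> value LUFU A v.
Proof.
move=> LA hv; apply/LUFU_value; case: v hv => -[hv _].
  by exists 0; left.
split; first exact/scriptL_base/script_L.
by exists 0; left; split; [exact: ext_Not|apply/(hlog.1 _ LA).2].
Qed.

Lemma LUFU_same A : sentence L A -> same V A LUFU A.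
Proof.
move=> LA; have [v hv] := ext_bivalent hL0 hbiv hlog LA.
exact: value_same hv (LUFU_value_ext LA hv).
Qed.

Lemma ext_sub_LT A : sentence L A -> sentence LT A.
Proof.
move=> LA; have [v hv] := ext_bivalent hL0 hbiv hlog LA.
exact: LUFU_value_sentence (LUFU_value_ext LA hv).
Qed.

Lemma LUFU_value_Not A v : value LUFU A v -> value LUFU (Not A) (~~ v).
Proof.
move=> hA; have sA := LUFU_value_scriptL hA.
move/LUFU_value: hA; case: v => hA; apply/LUFU_value; last by case: hA.
by split; [exact: scriptL_Not|apply: LU_of_step; exact: step_NotNot].
Qed.

(** Each of the sixteen values is provided by one case of one formation step;
    a false part enters through its negation. *)
Lemma LUFU_value_connectives A B a b : value LUFU A a -> value LUFU B b ->
  [/\ value LUFU (Or A B) (a || b), value LUFU (And A B) (a && b),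
      value LUFU (Imp A B) (a ==> b) & value LUFU (Iff A B) (a == b)].
Proof.
move=> hA hB; have sA := LUFU_value_scriptL hA; have sB := LUFU_value_scriptL hB.
have [sO sN sI sE] : [/\ scriptL L0 (Or A B), scriptL L0 (And A B),
    scriptL L0 (Imp A B) & scriptL L0 (Iff A B)].
  by split; apply: scriptL_compound; constructor.
(* Both premises in the form in which the formation steps take them. *)
have {}hA : LU (if a then A else Not A).
  by move/LUFU_value: hA; case: (a) => // -[].
have {}hB : LU (if b then B else Not B).
  by move/LUFU_value: hB; case: (b) => // -[].
case: a hA => hA; case: b hB => hB; split; apply/LUFU_value => /=;
  try (split=> //); apply: LU_of_step.
- by apply: step_Or => //; apply: Or31.
- exact: step_And.
- by apply: step_Imp => //; apply: Or33.
- by apply: step_Iff => //; left.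
- by apply: step_Or => //; apply: Or32.
- by apply: step_NotAnd => //; apply: Or33.
- exact: step_NotImp.
- by apply: step_NotIff => //; left.
- by apply: step_Or => //; apply: Or33.
- by apply: step_NotAnd => //; apply: Or31.
- by apply: step_Imp => //; apply: Or31.
- by apply: step_NotIff => //; right.
- exact: step_NotOr.
- by apply: step_NotAnd => //; apply: Or32.
- by apply: step_Imp => //; apply: Or32.
- by apply: step_Iff => //; right.
Qed.

(** The sets beyond Z enter the construction only for nonempty [U]; since L has
    a true sentence, Z alone already makes G(U) nonempty. *)
Lemma U_inhabited : exists n, U n.
Proof.
have [A [LA hA]] := ext_value_ex hL0 hbiv hlog true.
move/LUFU_value: (LUFU_value_ext LA hA) => h; exists (g A).
by apply/in_U => //; apply: LU_scriptL h.
Qed.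

Lemma LUFU_value_Tr A v : value LUFU A v -> value LUFU (Tr _ _ (quote g A)) v.
Proof.
move=> hA; have sA := LUFU_value_scriptL hA.
move/LUFU_value: hA => hA; apply/LUFU_value; case: v hA => hA.
  exists 0; right; split; first exact: U_inhabited.
  by left; exists A; split=> //; apply/in_U.
split; first exact/scriptL_base/(script_T _ false).
exists 0; right; split; first exact: U_inhabited.
by right; left; exists A; split=> //; apply/in_U; [exact: scriptL_Not|case: hA].
Qed.

Lemma LUFU_value_QT q b : value LUFU (Quant _ _ [:: q] (PT b)) (is_Ex q).
Proof.
apply/LUFU_value; case: q => /=; last first.
  exists 0; right; split; first exact: U_inhabited.
  by right; right; left; exists b; right.
split; first exact/scriptL_base/script_QT.
exists 0; right; split; first exact: U_inhabited.
by right; right; left; exists b; left.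
Qed.

Lemma LUFU_value_QTT q b c : value LUFU (Quant _ _ [:: q] (PTT b c)) (is_Ex q).
Proof.
apply/LUFU_value; case: q => /=; last first.
  exists 0; right; split; first exact: U_inhabited.
  by right; right; right; left; exists b, c; right.
split; first exact/scriptL_base/script_QTT.
exists 0; right; split; first exact: U_inhabited.
by right; right; right; left; exists b, c; left.
Qed.

(** A true sentence is in Z_3 if [b] is false, in Z_4 if [b] is true, and T- and
    ~T-sentences are exchanged by [Not]. So a false sentence is in F(U) by the true
    case for the dual prefix and the opposite [b]. *)
Lemma LUFU_value_QTP qs b c f v :
  predic L (PF c f) -> size qs = arity L (PF c f) ->
  value V (Quant _ _ qs (PF (b (+) c) f)) v ->
  value LUFU (Quant _ _ qs (PTP b c f)) v.
Proof.
move=> hP hs hv; have hP' := ext_predic_sign hL0 (b (+) c) hP.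
have pos rs d : size rs = arity L (PF c f) ->
    value V (Quant _ _ rs (PF (d (+) c) f)) true -> LU (Quant _ _ rs (PTP d c f)).
  move=> hrs [htr _]; exists 0; right; split; first exact: U_inhabited.
  by case: d htr => htr; right; right; right; right; [right|left];
    exists rs, c, f.
apply/LUFU_value; case: v hv => hv; first exact: pos.
split; first exact/scriptL_base/script_QTP.
apply: pos; first by rewrite size_map.
rewrite addNb; exact: (value_Quant_dual hL0 hlog hP' hs hv).
Qed.

(** The objects which the truth language adds to the domain of discourse are in
    the domain of no predicate of the basic extension. *)
Lemma namesets_PF c f : namesets LT (PF c f) = namesets L (PF c f).
Proof.
rewrite /namesets /= -map_comp; apply: eq_map => D /=.
apply: predext => t; split=> [[[d hd|? [[]]]]|[d hd]]; first by exists d.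
by exists (inl d).
Qed.

Lemma namesets_PTP b c f : namesets LT (PTP b c f) = namesets L (PF c f).
Proof. exact: namesets_PF. Qed.

Lemma arity_LT b c f : arity LT (PF c f) = arity L (PF c f) /\
  arity LT (PTP b c f) = arity L (PF c f).
Proof. by rewrite -!size_namesets namesets_PF namesets_PTP. Qed.

Definition sentence_name t := exists2 A, sentence LT A & t = quote g A.

Lemma namesets_PT b : namesets LT (PT b) = [:: sentence_name].
Proof.
congr cons; apply: predext => t.
split=> [[[? [[]]|[A hA] [_ /= ->]]]|[A hA ->]]; first by exists A.
by exists (inr (exist _ A hA)).
Qed.

Lemma namesets_PTT b c : namesets LT (PTT b c) = [:: sentence_name].
Proof. exact: (namesets_PT b). Qed.

Lemma LT_Not A : sentence LT A -> sentence LT (Not A).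
Proof. by case/LUFU_value_ex => v /LUFU_value_Not /LUFU_value_sentence. Qed.

Lemma LT_Tr A : sentence LT A -> sentence LT (Tr _ _ (quote g A)).
Proof. by case/LUFU_value_ex => v /LUFU_value_Tr /LUFU_value_sentence. Qed.

Lemma LT_Tlit b A : sentence LT A -> sentence LT (Tlit b (quote g A)).
Proof. by move=> /LT_Tr; case: b => // /LT_Not. Qed.

Lemma LT_inst_PF c f bs : predic L (PF c f) ->
  in_product (namesets L (PF c f)) bs -> sentence LT (inst g (PF c f) bs).
Proof. by move=> hP hbs; apply/ext_sub_LT/ext_inst. Qed.

Lemma LT_is_predicate P : predic LT P -> is_predicate g LT P.
Proof.
move=> hP; have named : all_named LT.
  case=> [d|[A hA]]; last by exists (quote g A).
  by have [_ named _ _ _] := hL0; apply: (named d).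
split=> //.
  case: P hP => //= [c f|b c f] hP; rewrite /arity size_map;
    exact: (ext_arity_gt0 hL0 hP).
case: P hP => [c f|b|b c|b c f] hP bs.
- by rewrite namesets_PF; apply: LT_inst_PF.
- rewrite namesets_PT; case: bs => [|t [|? ?]] [] //= [A hA ->] _.
  exact: LT_Tlit.
- rewrite namesets_PTT; case: bs => [|t [|? ?]] [] //= [A hA ->] _.
  exact/LT_Tlit/LT_Tlit.
- by rewrite namesets_PTP => /(LT_inst_PF hP); apply: LT_Tlit.
Qed.

(** Every new sentence is in the language for having a value under [LUFU]. *)
Lemma LT_closure : closure_property g LT.
Proof.
split; first exact: LT_Not.
split=> [A B /LUFU_value_ex [a hA] /LUFU_value_ex [b hB]|P hP].
  by have [? ? ? ?] := LUFU_value_connectives hA hB;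
    split; apply: LUFU_value_sentence; eassumption.
have hnP : predic LT (notP P).
  by case: P hP => //= c f; apply: (ext_predic_sign hL0).
split; [exact: LT_is_predicate| |exact: LT_is_predicate|by case: P hP {hnP}].
move=> qs; case: P hP {hnP} => [c f|b|b c|b c f] hP.
- by rewrite (arity_LT false c f).1 => hs; apply/ext_sub_LT/ext_Quant.
- by case: qs => [|q []] // _; apply: LUFU_value_sentence (LUFU_value_QT q b).
- by case: qs => [|q []] // _; apply: LUFU_value_sentence (LUFU_value_QTT q b c).
- rewrite (arity_LT b c f).2 => hs.
  have hP' := ext_predic_sign hL0 (b (+) c) hP.
  have [v hv] := ext_bivalent hL0 hbiv hlog (ext_Quant hP' hs).
  exact: LUFU_value_sentence (LUFU_value_QTP hP hs hv).
Qed.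

(** * Quantified sentences under the meaning of T *)

(** These lemmas apply both to [LUFU], for which the quantifier rules are to be
    proved, and to an arbitrary valuation by meanings, for which they are given;
    this is why those on the T-predicates state an equivalence. *)
Section Meaning.
Variable W : valuation S.
Hypothesis hNot : Not_rule LT W.
Hypothesis hT : T_meaning g LT W.
Hypothesis hVW : forall A, sentence L A -> same V A W A.

Lemma value_Not_LT A v : sentence LT A ->
  value W A v -> value W (Not A) (~~ v).
Proof. by move=> hA hv; apply/(value_Not _ hNot hA); rewrite negbK. Qed.

Lemma value_Tr A v : sentence LT A ->
  value W A v -> value W (Tr _ _ (quote g A)) v.
Proof. by move=> /hT/same_sym; apply: same_value. Qed.

Lemma value_Tlit b A v : sentence LT A ->
  value W A v -> value W (Tlit b (quote g A)) (b (+) v).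
Proof.
move=> hA hv; have h := value_Tr hA hv; case: b => //.
exact: (value_Not_LT (LT_Tr hA) h).
Qed.

Lemma LT_value_ex v :
  exists A, [/\ sentence LT A, sentence_name (quote g A) & value W A v].
Proof.
have [A [LA hv]] := ext_value_ex hL0 hbiv hlog v.
have hA := ext_sub_LT LA.
by exists A; split; [|exists A|exact: same_value (hVW LA) hv].
Qed.

Lemma rule_QPF c f qs : predic L (PF c f) -> size qs = arity L (PF c f) ->
  quantifier_rule g LT W (PF c f) qs.
Proof.
move=> hP hs; have rV := hlog.2.2 _ _ hP hs.
apply/(quantifier_rule_transfer (namesets_PF c f) hs _ rV).
  by move=> bs /(ext_inst hL0 hP); apply: hVW.
exact/hVW/ext_Quant.
Qed.

(** Under the meaning of T the predicate T_1(<P>) has the same instance values as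
    P or its negation in the basic extension: the two signs [b] and [c] add up. *)
Lemma rule_QPTP b c f qs : predic L (PF c f) -> size qs = arity L (PF c f) ->
  quantifier_rule g LT W (PTP b c f) qs <->
  same V (Quant _ _ qs (PF (b (+) c) f)) W (Quant _ _ qs (PTP b c f)).
Proof.
move=> hP hs.
have hP' := ext_predic_sign hL0 (b (+) c) hP.
have rV := hlog.2.2 _ _ hP' hs.
have eN : namesets LT (PTP b c f) = namesets L (PF (b (+) c) f).
  exact: namesets_PTP.
apply: (quantifier_rule_transfer eN hs _ rV) => bs hbs.
have L0A := sentence_subst hL0 hP hbs; have LA := ext_base L0A.
have [v hv] := ext_bivalent hL0 hbiv hlog LA.
apply: (@value_same _ _ _ _ _ (b (+) (c (+) v))).
  case: (b) (c) => -[] /=; rewrite ?negbK //;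
    by apply/(value_Not _ hlog.1 LA); rewrite negbK.
apply: value_Tlit; first exact: LT_inst_PF.
apply: same_value (hVW (ext_inst hL0 hP hbs)) _.
by case: (c) => //=; apply/(value_Not _ hlog.1 LA); rewrite negbK.
Qed.

(** The sign [b] swaps the values, so that the true instance is at a sentence
    with value [~~ b]. *)
Lemma rule_QPT b q : quantifier_rule g LT W (PT b) [:: q] <->
  value W (Quant _ _ [:: q] (PT b)) (is_Ex q).
Proof.
have [A [hA nA vA]] := LT_value_ex (~~ b).
have [B [hB nB vB]] := LT_value_ex b.
apply: (quantifier_rule_mixed q (namesets_PT b) nA nB).
  by have := value_Tlit b hA vA; rewrite addbN addbb.
by have := value_Tlit b hB vB; rewrite addbb.
Qed.

Lemma rule_QPTT b c q : quantifier_rule g LT W (PTT b c) [:: q] <->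
  value W (Quant _ _ [:: q] (PTT b c)) (is_Ex q).
Proof.
have [A [hA nA vA]] := LT_value_ex (~~ (b (+) c)).
have [B [hB nB vB]] := LT_value_ex (b (+) c).
apply: (quantifier_rule_mixed q (namesets_PTT b c) nA nB).
  have := value_Tlit b (LT_Tlit c hA) (value_Tlit c hA vA).
  by rewrite addbA addbN addbb.
have := value_Tlit b (LT_Tlit c hB) (value_Tlit c hB vB).
by rewrite addbA addbb.
Qed.

End Meaning.

Lemma LUFU_Not_rule : Not_rule LT LUFU.
Proof.
move=> A /LUFU_value_ex [v hv]; have := LUFU_value_Not hv; move: hv.
by rewrite /value; case: v => /=; tauto.
Qed.

Lemma LUFU_T_meaning : T_meaning g LT LUFU.
Proof.
move=> A /LUFU_value_ex [v hv].
exact: (value_same (LUFU_value_Tr hv) hv).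
Qed.

Lemma LUFU_truth_rules : classical_truth_rules g LT LUFU.
Proof.
have hN := LUFU_Not_rule; have hT := LUFU_T_meaning.
split=> //; split=> [A B /LUFU_value_ex [a hA] /LUFU_value_ex [b hB]|P qs hP].
  by apply/(value_connectives hA hB)/LUFU_value_connectives.
case: P hP => [c f|b|b c|b c f] hP.
- by rewrite (arity_LT false c f).1; apply: (rule_QPF LUFU_same).
- case: qs => [|q []] // _.
  by apply/(rule_QPT hN hT LUFU_same)/LUFU_value_QT.
- case: qs => [|q []] // _.
  by apply/(rule_QPTT hN hT LUFU_same)/LUFU_value_QTT.
- rewrite (arity_LT b c f).2 => hs.
  apply/(rule_QPTP hN hT LUFU_same b hP hs).
  have hP' := ext_predic_sign hL0 (b (+) c) hP.
  have [v hv] := ext_bivalent hL0 hbiv hlog (ext_Quant hP' hs).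
  exact: value_same hv (LUFU_value_QTP hP hs hv).
Qed.

Lemma LUFU_by_meanings : by_meanings g L0 LT V LUFU.
Proof.
split; [|exact: LUFU_truth_rules|exact: LUFU_T_meaning].
by move=> A /ext_base; apply: LUFU_same.
Qed.

(** * Uniqueness of the valuation by meanings *)

Section Uniqueness.
Variable W : valuation S.
Hypothesis hW : by_meanings g L0 LT V W.

Lemma meaning_same A : sentence L A -> same V A W A.
Proof.
have [hV rW _] := hW; move: A.
apply: (ext_agree hL0 hlog rW hV ext_sub_LT) => c f hP.
by split=> //; apply: namesets_PF.
Qed.

(** Soundness of the formation steps. The premises have to be in L(U) too, for W
    obeys the truth rules on the truth language only. *)
Lemma LU_step_true X C :
  (forall A, X A -> LU A /\ value W A true) ->
  LU_step L0 X C -> value W C true.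
Proof.
move=> hX; have [_ [hN [hC _]] _] := hW.
have pos A : X A -> sentence LT A /\ value W A true.
  by move=> /hX [? ?]; split=> //; left.
have neg A : scriptL L0 A -> X (Not A) -> sentence LT A /\ value W A false.
  move=> sA /hX [hA hv]; have LTA : sentence LT A by right.
  by split=> //; apply/(value_Not true hN LTA).
have conn A B a b : sentence LT A /\ value W A a -> sentence LT B /\ value W B b ->
    [/\ value W (Or A B) (a || b), value W (And A B) (a && b),
        value W (Imp A B) (a ==> b) & value W (Iff A B) (a == b)].
  by move=> [LA hA] [LB hB]; apply/(value_connectives hA hB)/hC.
have negc A : sentence LT A -> value W A false -> value W (Not A) true.
  by move=> ? ?; apply/(value_Not _ hN).
have closed A B a b : sentence LT A /\ value W A a -> sentence LT B /\ value W B b ->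
    [/\ sentence LT (Or A B), sentence LT (And A B), sentence LT (Imp A B)
      & sentence LT (Iff A B)].
  by move=> [LA _] [LB _]; have [_ [h _]] := LT_closure; apply: h.
case=> [A sA /pos [hA vA]|A B sA sB|A B sA sB|A B sA sB|A B sA sB|A B sA sB
       |A B sA sB|A B sA sB|A B sA sB].
- exact: (value_Not_LT hN (LT_Not hA) (value_Not_LT hN hA vA)).
- by case=> -[]; [move=> /pos hA /pos hB|move=> /pos hA /(neg _ sB) hB
    |move=> /(neg _ sA) hA /pos hB]; case: (conn _ _ _ _ hA hB).
- by case=> /pos hA /pos hB; case: (conn _ _ _ _ hA hB).
- by case=> -[]; [move=> /(neg _ sA) hA /pos hB
    |move=> /(neg _ sA) hA /(neg _ sB) hB|move=> /pos hA /pos hB];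
    case: (conn _ _ _ _ hA hB).
- by case=> -[]; [move=> /pos hA /pos hB|move=> /(neg _ sA) hA /(neg _ sB) hB];
    case: (conn _ _ _ _ hA hB).
- case=> /(neg _ sA) hA /(neg _ sB) hB; have [? ? ? ?] := closed _ _ _ _ hA hB.
  by apply: negc => //; case: (conn _ _ _ _ hA hB).
- by case=> -[]; [move=> /(neg _ sA) hA /pos hB
    |move=> /(neg _ sA) hA /(neg _ sB) hB|move=> /pos hA /(neg _ sB) hB];
    have [? ? ? ?] := closed _ _ _ _ hA hB; apply: negc => //;
    case: (conn _ _ _ _ hA hB).
- case=> /pos hA /(neg _ sB) hB; have [? ? ? ?] := closed _ _ _ _ hA hB.
  by apply: negc => //; case: (conn _ _ _ _ hA hB).
- by case=> -[]; [move=> /pos hA /(neg _ sB) hB|move=> /(neg _ sA) hA /pos hB];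
    have [? ? ? ?] := closed _ _ _ _ hA hB; apply: negc => //;
    case: (conn _ _ _ _ hA hB).
Qed.

(** Induction on the least fixed point [U] and, inside, on the level in the
    construction of L(U). The outer hypothesis gives the truth of A when T(<A>)
    is reached at level 0 through Z_1(U), and its falsity when ~T(<A>) is reached
    through Z_2(U). *)
Lemma LU_true B : LU B -> value W B true.
Proof.
pose X n := forall A, scriptL L0 A -> n = g A -> value W A true.
suff hX n : U n -> X n.
  by move=> hB; have sB := LU_scriptL hB; apply: (hX (g B)) => //; apply/in_U.
move: n; apply: (smallest_consistent_fixpoint_ind hU) => n [C [hC ->]] D sD E.
rewrite -(hg (LU_scriptL hC) sD E) => {D sD E}.
have [_ [hN [hC' hQ]] hT] := hW; have hVW := meaning_same.
case: hC => k; elim: k C => [|k IH] C; last first.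
  case=> [/IH//|]; apply: LU_step_true => A hA; split; last exact: IH.
  (* LU is monotone, so what is derived from U /\ X is derived from U. *)
  by apply: (@LU_sub _ _ _ _ (fun m => U m /\ X m)) => [m []|]; last exists k.
case=> [[LC trC]|[_]].
  have [v hv] := ext_bivalent hL0 hbiv hlog LC.
  by case: v hv => hv; [apply: same_value (hVW _ LC) hv|case: hv].
case=> [[A [sA [UA XA] ->]]|].
  by apply: (value_Tr hT); [left; apply/in_U|exact: XA].
case=> [[A [sA [UA XA] ->]]|].
  have LTA : sentence LT A.
    by right; split=> //; apply/in_U => //; apply: scriptL_Not.
  apply: (value_Not_LT (v := false) hN (LT_Tr LTA)).
  apply: (value_Tr hT LTA); apply/(value_Not true hN LTA).
  by apply: XA => //; apply: scriptL_Not.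
have qT b q : value W (Quant _ _ [:: q] (PT b)) (is_Ex q).
  by apply/(rule_QPT hN hT hVW)/hQ.
have qTT b c q : value W (Quant _ _ [:: q] (PTT b c)) (is_Ex q).
  by apply/(rule_QPTT hN hT hVW)/hQ.
case=> [[b [->|->]]|].
- apply: (value_Not_LT (v := false) hN); last exact: (qT b All).
  exact: LUFU_value_sentence (LUFU_value_QT All b).
- exact: (qT b Ex).
case=> [[b [c [->|->]]]|].
- apply: (value_Not_LT (v := false) hN); last exact: (qTT b c All).
  exact: LUFU_value_sentence (LUFU_value_QTT All b c).
- exact: (qTT b c Ex).
have qTP b c f qs : predic L (PF c f) -> size qs = arity L (PF c f) ->
    is_tr V (Quant _ _ qs (PF (b (+) c) f)) ->
    value W (Quant _ _ qs (PTP b c f)) true.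
  move=> hP hs trV.
  have hP' := ext_predic_sign hL0 (b (+) c) hP.
  have [v hv] := ext_bivalent hL0 hbiv hlog (ext_Quant hP' hs).
  have {}hv : value V (Quant _ _ qs (PF (b (+) c) f)) true.
    by case: v hv => // -[].
  apply: same_value hv; apply/(rule_QPTP hN hT hVW b hP hs)/hQ => //.
  by rewrite (arity_LT b c f).2.
by case=> -[qs [c [f [hP hs htr ->]]]]; apply: qTP.
Qed.

(** The converse of [LU_true] holds because each sentence of the truth language
    is in L(U) or in F(U), and both values are definite. *)
Lemma LUFU_same_meaning A : sentence LT A -> same LUFU A W A.
Proof.
move=> hA; have [v hv] := LUFU_value_ex hA; apply: (value_same hv).
move/LUFU_value: hv; case: v => [/LU_true//|[_ /LU_true h]].
by have [_ [hN _] _] := hW; apply/(value_Not true hN hA).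
Qed.

(** T(<A>) has the value of [A] and ~T(<A>) the opposite one, whence the
    biconditional with [A] is true in the first case and false in the second. *)
Lemma value_T_Iff b A : sentence LT A ->
  value W (Iff (Tlit b (quote g A)) A) (~~ b).
Proof.
move=> hA; have [v hv0] := LUFU_value_ex hA.
have hv := same_value (LUFU_same_meaning hA) hv0.
have [_ [hN [hC _]] hT] := hW.
have [_ _ _] := (value_connectives (value_Tlit hN hT b hA hv) hv).1
  (hC _ _ (LT_Tlit b hA) hA).
by case: b; case: (v).
Qed.

Lemma T_biconditional_formed b A : sentence LT A ->
  in_product (namesets LT (PT b)) [:: quote g A] /\
  sentence LT (Iff (Tlit b (quote g A)) A).
Proof.
move=> hA; split; first by rewrite namesets_PT; split=> //; exists A.
by have [_ [h _]] := LT_closure; case: (h _ _ (LT_Tlit b hA) hA).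
Qed.

Lemma T_truth_predicate : truth_predicate g LT W (PT false).
Proof.
split=> // [|A hA]; first exact: LT_is_predicate.
by have [? ?] := T_biconditional_formed false hA; split=> //;
  case: (value_T_Iff false hA).
Qed.

Lemma notT_non_truth_predicate : non_truth_predicate g LT W (PT true).
Proof.
split=> // [|A hA]; first exact: LT_is_predicate.
by have [? ?] := T_biconditional_formed true hA; split=> //;
  case: (value_T_Iff true hA).
Qed.

Lemma LT_bivalent : bivalent LT W.
Proof.
apply/bivalentP => A hA; have [v hv] := LUFU_value_ex hA.
by exists v; apply: same_value (LUFU_same_meaning hA) hv.
Qed.

End Uniqueness.
End TruthLanguage.

Unset Implicit Arguments.

Theorem theorem5p2 (S : syntax) (L0 : language S) (V : valuation S)
    (g : expr S -> nat) (U : nat -> Prop)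
    (hL0 : is_base_language g L0)
    (hnoT : ~ exists P, truth_predicate g L0 V P)
    (hbiv : bivalent L0 V)
    (hlog : classical_truth_rules g (basic_extension L0) V)
    (hg : godel_numbering L0 g)
    (hU : smallest_consistent_fixpoint L0 V g U) :
  let LT := truth_language L0 V g U in
  (exists W, by_meanings g L0 LT V W) /\
  forall W, by_meanings g L0 LT V W ->
    has_semantical_theory_of_truth g LT (by_meanings g L0 LT V) W /\
    (forall A, sentence LT A ->
       (is_tr W A <-> LU L0 V g U A) /\ (is_fa W A <-> FU L0 V g U A)) /\
    closure_property g LT /\
    classical_truth_rules g LT W /\
    bivalent LT W /\
    truth_predicate g LT W (PT false) /\
    non_truth_predicate g LT W (PT true).
Proof.
move=> LT; split.
  by exists (Valuation (LU L0 V g U) (FU L0 V g U)); apply: LUFU_by_meanings.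
move=> W hW; have same_LUFU := LUFU_same_meaning hL0 hbiv hlog hg hU.
have biv : bivalent LT W by apply: LT_bivalent.
have hT : truth_predicate g LT W (PT false) by apply: T_truth_predicate.
split.
  split=> //; first by split=> //; exists (PT false).
  move=> W' hW' A hA; apply: same_trans (same_LUFU W' hW' A hA).
  exact: same_sym (same_LUFU W hW A hA).
split; first by move=> A hA; apply: same_sym (same_LUFU W hW A hA).
split; first exact: LT_closure.
split; first by case: hW.
by do 2!split=> //; apply: notT_non_truth_predicate.
Qed.
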